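(* Let $n\ge 2$, let $\mathcal B$ be the level-$1$ perfect crystal of type $C_n^{(1)}$ described in the context, and let $\mathcal S/\!\sim$ be the set of equivalence classes of level-$1$ slices of type $C_n^{(1)}$, equipped with the Kashiwara operators $\tilde e_i,\tilde f_i$ ($i=0,\dots,n$) induced from the slice operators described in the context. Then the map $\Phi:\mathcal B\to\mathcal S/\!\sim$ described in the context is an isomorphism of $U_q'(C_n^{(1)})$-crystals.
   Context: Let $n\ge2$, $I=\{0,1,\dots,n\}$. The perfect crystal $\mathcal B$: it is the set of $b=(x_1,\dots,x_n\,|\,\bar x_n,\dots,\bar x_1)$ with $x_i,\bar x_i\in\mathbb Z_{\ge0}$ and $\sum_i(x_i+\bar x_i)\in\{0,2\}$. The operators are: $\tilde f_0 b$ adds $2$ to $x_1$ if $x_1\ge\bar x_1$; adds $1$ to $x_1$ and subtracts $1$ from $\bar x_1$ if $x_1=\bar x_1-1$; subtracts $2$ from $\bar x_1$ if $x_1\le \bar x_1-2$. For $1\le i\le n-1$: $\tilde f_i b$ replaces $(x_i,x_{i+1})$ by $(x_i-1,x_{i+1}+1)$ if $x_{i+1}\ge\bar x_{i+1}$, and replaces $(\bar x_{i+1},\bar x_i)$ by $(\bar x_{i+1}-1,\bar x_i+1)$ if $x_{i+1}<\bar x_{i+1}$. $\tilde f_n b$ replaces $(x_n,\bar x_n)$ by $(x_n-1,\bar x_n+1)$. $\tilde e_0 b$ subtracts $2$ from $x_1$ if $x_1\ge\bar x_1+2$; subtracts $1$ from $x_1$ and adds $1$ to $\bar x_1$ if $x_1=\bar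 x_1+1$; adds $2$ to $\bar x_1$ if $x_1\le\bar x_1$. For $1\le i\le n-1$: $\tilde e_i b$ replaces $(x_i,x_{i+1})$ by $(x_i+1,x_{i+1}-1)$ if $x_{i+1}>\bar x_{i+1}$, and $(\bar x_{i+1},\bar x_i)$ by $(\bar x_{i+1}+1,\bar x_i-1)$ if $x_{i+1}\le\bar x_{i+1}$. $\tilde e_n b$ replaces $(x_n,\bar x_n)$ by $(x_n+1,\bar x_n-1)$. In all cases the result is $0$ if it leaves the set $\mathcal B$ (a negative entry). Also $\varphi_i(b)=\max\{m:\tilde f_i^m b\ne0\}$, $\varepsilon_i(b)=\max\{m:\tilde e_i^m b\ne0\}$, $\mathrm{wt}(b)=\sum_i(\varphi_i(b)-\varepsilon_i(b))\Lambda_i$. Blocks and the pattern: a $0$-block has half-unit height; an $i$-block ($1\le i\le n$) has unit height. A level-$\tfrac12$ slice is a finite set of blocks stacked in one column forming an initial segment of the infinite periodic pattern which, read from the bottom, is $0,0,1,2,\dots,n-1,n,n-1,\dots,2,1,0,0,1,2,\dots$ (the empty slice is allowed). In this pattern, for $1\le i\le n-1$, an $i$-position on an ascending run $1,2,\dots,n$ (closer to the $n$-position above it) is called supporting, and one on a descending run $n,\dots,1$ (closer to the $n$-position below it) is called covering; $0$-positions are covering; $n$-positions are both supporting and covering. A ''$\delta$'' is a consecutive run of the pattern containing one $n$-block and two $i$-blocks for each $i=0,\dots,n-1$; for a level-$\tfrac12$ slice $c$, $c+\delta$ is $c$ with the next such run stacked on top, and $c-\delta$ (when $c$ contains a $\delta$)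 removes the top such run. The ''slot'' at the top of $c$ is the first unfilled position of the pattern above $c$. Level-$1$ slice: an ordered pair $C=(c_1,c_2)$ of level-$\tfrac12$ slices with $c_1\subseteq c_2\subseteq c_1+\delta$ (as initial segments) and with an even total number of $0$-blocks; $c_j$ is the $j$th layer. $\mathcal S$ denotes the set of level-$1$ slices. Splitting: for $0<i<n$, an $i$-block can be split in $C$ if the top block of one layer is a covering $i$-block and the top of the other layer is an $(i-1)$-block occupying the position immediately below a supporting $i$-position (i.e. its slot is a supporting $i$-slot); splitting moves the top half of that covering $i$-block onto that supporting $i$-slot. An $n$-block can be split if one layer has top block $n$ and the other layer's slot is an $n$-slot. $0$-blocks are never split. Slice operators for $1\le i\le n$, $\tilde f_iC$: (1) if $i\ne n$ and an $(i+1)$-block can be split in $C$, the result is $0$; (2) else if neither layer's top slot is an $i$-slot, result $0$; (3) else if exactly one is, put an $i$-block there; (4) else (both top slots are $i$-slots) if $i=n$ or both slots are of the same kind (supporting/covering): if they are at different heights put the $i$-block in the first layer (the lower slot), otherwise in the second layer; (5) otherwise put the $i$-block in the covering slot. $\tilde f_0C$: if a $1$-block can be split, $0$; if no top slot is a $0$-slot, $0$; if both top slots are $0$-slots, add one $0$-block to each layer; if exactly one is, add two $0$-blocks to that layer. $\tilde e_iC$ ($1\le i\le n$): (1) if $i\ne n$ and an $(i+1)$-block can be split, $0$; (2) if neither top block is an $i$-block, $0$; (3) if exactly one top block is an $i$-block, remove it; (4) if both are and ($i=n$ or same kind): at different heights remove the one in the second layer (the higher), otherwise remove the one in the first layer;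 (5) otherwise remove the supporting $i$-block. $\tilde e_0C$: if a $1$-block can be split, $0$; if neither top block is a $0$-block, $0$; if both are, remove one $0$-block from each layer; if exactly one, remove two $0$-blocks from that layer. If the result is not a level-$1$ slice, it is taken to be $0$. Equivalence: for $C=(c_1,c_2)$ set $C+\delta=(c_2,c_1+\delta)$, and if $c_2\supseteq\delta$, $C-\delta=(c_2-\delta,c_1)$. $C\sim C'$ if one is obtained from the other by adding finitely many $\delta$'s. The operators above commute with $C\mapsto C+\delta$ and hence descend to $\mathcal S/\!\sim$. The map $\Phi$: first define level-$\tfrac12$ slices $P(\cdot)$ for elements of total sum $0$ or $1$: $P(0,\dots,0|0,\dots,0)$ is a single $0$-block; $P(e_1)$ (i.e. $x_1=1$, rest $0$) is two $0$-blocks; for $2\le i\le n$, $P(e_i)$ ($x_i=1$) is the column $0,0,1,\dots,i-1$; $P(\bar e_n)$ ($\bar x_n=1$) is $0,0,1,\dots,n$; for $1\le i\le n-1$, $P(\bar e_i)$ ($\bar x_i=1$) is $0,0,1,\dots,n,n-1,\dots,i$. Any $b\in\mathcal B$ is written as $b=u+u'$ with $u,u'$ of total sum $0$ (if $b=0$) or $1$; $\Phi(b)$ is the $\sim$-class of the level-$1$ slice whose two layers are $P(u)$ and $P(u')$, after possibly adding a $\delta$ to one of them so that the pair is a level-$1$ slice (the class does not depend on the choices).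
   Formalization: The operators on a class are evaluated at the representative Φ(b), with nonempty layers: on slices with an empty layer they fail to commute with adding δ (f_0 of (∅,{0,0}) is nonzero, after +δ it is 0). Preservation of ε, φ, wt follows from commutation and is not stated. *)

(* Defs.v *)
From mathcomp Require Import all_boot all_algebra.
Set Implicit Arguments. Unset Strict Implicit. Unset Printing Implicit Defensive.
Import GRing.Theory Num.Theory.

(* An element (x_1..x_n | xbar_n..xbar_1) is a pair of finite functions   *)
(* 'I_n -> nat: b.1 j = x_(j+1), b.2 j = xbar_(j+1).                       *)

Definition Bt (n : nat) := ({ffun 'I_n -> nat} * {ffun 'I_n -> nat})%type.

(* coordinate i (1 <= i <= n) of a finite function; 0 outside the range *)
Definition getc (n : nat) (f : {ffun 'I_n -> nat}) (i : nat) : nat :=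
  if i is i'.+1 then
    (if (insub i' : option 'I_n) is Some j then f j else 0%N) else 0%N.

Definition bx n (b : Bt n) (i : nat) : nat := getc b.1 i.
Definition bxb n (b : Bt n) (i : nat) : nat := getc b.2 i.

Definition totsum n (b : Bt n) : nat := sumn [seq (b.1 j + b.2 j)%N | j <- enum 'I_n].

Definition inB n (b : Bt n) : bool := (totsum b == 0%N) || (totsum b == 2%N).

Definition addv n (f : {ffun 'I_n -> nat}) (d : nat -> int)
  : option {ffun 'I_n -> nat} :=
  if [forall j : 'I_n, (0 <= (f j)%:Z + d j.+1)%R]
  then Some [ffun j : 'I_n => absz ((f j)%:Z + d j.+1)%R]
  else None.

Definition shiftB n (b : Bt n) (dx dxb : nat -> int) : option (Bt n) :=
  match addv b.1 dx, addv b.2 dxb with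
  | Some a, Some c => if inB (a, c) then Some (a, c) else None
  | _, _ => None
  end.

Definition uvec (i : nat) (v : int) : nat -> int :=
  fun j => if j == i then v else 0%R.
Definition vadd (d d' : nat -> int) : nat -> int := fun j => (d j + d' j)%R.
Definition vzero : nat -> int := fun _ => 0%R.

Definition fB n (i : nat) (b : Bt n) : option (Bt n) :=
  if i == 0%N then
    (if bx b 1 >= bxb b 1 then shiftB b (uvec 1 2) vzero
     else if (bx b 1).+1 == bxb b 1 then shiftB b (uvec 1 1) (uvec 1 (-1))
     else shiftB b vzero (uvec 1 (-2)))
  else if i < n then
    (if bx b i.+1 >= bxb b i.+1
     then shiftB b (vadd (uvec i (-1)) (uvec i.+1 1)) vzero
     else shiftB b vzero (vadd (uvec i.+1 (-1)) (uvec i 1)))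
  else if i == n then shiftB b (uvec n (-1)) (uvec n 1)
  else None.

Definition eB n (i : nat) (b : Bt n) : option (Bt n) :=
  if i == 0%N then
    (if bx b 1 >= (bxb b 1).+2 then shiftB b (uvec 1 (-2)) vzero
     else if bx b 1 == (bxb b 1).+1 then shiftB b (uvec 1 (-1)) (uvec 1 1)
     else shiftB b vzero (uvec 1 2))
  else if i < n then
    (if bx b i.+1 > bxb b i.+1
     then shiftB b (vadd (uvec i 1) (uvec i.+1 (-1))) vzero
     else shiftB b vzero (vadd (uvec i.+1 1) (uvec i (-1))))
  else if i == n then shiftB b (uvec n 1) (uvec n (-1))
  else None.

(* Slices.  The pattern (read from the bottom, positions 0,1,2,...) is    *)
(* periodic of period 2n+1: 0,0,1,...,n-1,n,n-1,...,1.  A level-1/2 slice *)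
(* (an initial segment of the pattern) is encoded by its number k of      *)
(* blocks; its slot is position k, its top block is position k-1.         *)

Definition per (n : nat) : nat := (2 * n).+1.   (* length of a delta *)

Definition color (n p : nat) : nat :=
  let q := p %% per n in
  if q <= 1 then 0%N else if q <= n.+1 then q.-1 else (per n - q)%N.

(* supporting positions: ascending 1..n-1 and the n-position *)
Definition supporting (n p : nat) : bool :=
  let q := p %% per n in (2 <= q) && (q <= n.+1).
(* covering positions: 0-positions, the n-position, descending n-1..1 *)
Definition covering (n p : nat) : bool :=
  let q := p %% per n in (q <= 1) || (n.+1 <= q).

Definition nzero (n k : nat) : nat := count (fun p => color n p == 0%N) (iota 0 k).

(* height (in half units: 0-block = 1, other blocks = 2) of the first
   k blocks, i.e. the height of the slot of a slice with k blocks *)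
Definition height (n k : nat) : nat :=
  sumn [seq (if color n p == 0%N then 1 else 2)%N | p <- iota 0 k].

Definition slice := (nat * nat)%type.

Definition isSlice (n : nat) (C : slice) : bool :=
  [&& C.1 <= C.2, C.2 <= C.1 + per n & ~~ odd (nzero n C.1 + nzero n C.2)].

Definition topIs (n k i : nat) : bool := (0 < k) && (color n k.-1 == i).
Definition slotIs (n k i : nat) : bool := color n k == i.

Definition splitAB (n j ka kb : nat) : bool :=
  if (0 < j) && (j < n) then
    [&& topIs n ka j, covering n ka.-1, topIs n kb j.-1,
        slotIs n kb j & supporting n kb]
  else if j == n then topIs n ka n && slotIs n kb n
  else false.

Definition canSplit (n : nat) (C : slice) (j : nat) : bool :=
  splitAB n j C.1 C.2 || splitAB n j C.2 C.1.

Definition chk (n : nat) (C : slice) : option slice :=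
  if isSlice n C then Some C else None.

Definition add2z (n k : nat) : option nat :=
  if (color n k == 0%N) && (color n k.+1 == 0%N) then Some k.+2 else None.
Definition rem2z (n k : nat) : option nat :=
  if [&& 1 < k, color n k.-1 == 0%N & color n k.-2 == 0%N]
  then Some k.-2 else None.

Definition fS (n i : nat) (C : slice) : option slice :=
  if i == 0%N then
    (if canSplit n C 1 then None else
     match slotIs n C.1 0, slotIs n C.2 0 with
     | true, true => chk n (C.1.+1, C.2.+1)
     | true, false =>
         if add2z n C.1 is Some k then chk n (k, C.2) else None
     | false, true =>
         if add2z n C.2 is Some k then chk n (C.1, k) else None
     | false, false => None
     end)
  else if n < i then None
  else if (i != n) && canSplit n C i.+1 then None
  else match slotIs n C.1 i, slotIs n C.2 i with
       | false, false => None
       | true, false => chk n (C.1.+1, C.2)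
       | false, true => chk n (C.1, C.2.+1)
       | true, true =>
           if (i == n) || (supporting n C.1 == supporting n C.2) then
             (if height n C.1 != height n C.2 then chk n (C.1.+1, C.2)
              else chk n (C.1, C.2.+1))
           else if covering n C.1 then chk n (C.1.+1, C.2)
           else chk n (C.1, C.2.+1)
       end.

Definition eS (n i : nat) (C : slice) : option slice :=
  if i == 0%N then
    (if canSplit n C 1 then None else
     match topIs n C.1 0, topIs n C.2 0 with
     | true, true => chk n (C.1.-1, C.2.-1)
     | true, false =>
         if rem2z n C.1 is Some k then chk n (k, C.2) else None
     | false, true =>
         if rem2z n C.2 is Some k then chk n (C.1, k) else None
     | false, false => None
     end)
  else if n < i then None
  else if (i != n) && canSplit n C i.+1 then None
  else match topIs n C.1 i, topIs n C.2 i with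
       | false, false => None
       | true, false => chk n (C.1.-1, C.2)
       | false, true => chk n (C.1, C.2.-1)
       | true, true =>
           if (i == n) || (supporting n C.1.-1 == supporting n C.2.-1) then
             (if height n C.1.-1 != height n C.2.-1 then chk n (C.1, C.2.-1)
              else chk n (C.1.-1, C.2))
           else if supporting n C.1.-1 then chk n (C.1.-1, C.2)
           else chk n (C.1, C.2.-1)
       end.

Definition plusd (n : nat) (C : slice) : slice := (C.2, C.1 + per n).

Definition sim (n : nat) (C C' : slice) : Prop :=
  exists m, iter m (plusd n) C = C' \/ iter m (plusd n) C' = C.

(* equality in S/~ of possibly-zero results *)
Definition osim (n : nat) (o o' : option slice) : Prop :=
  match o, o' with
  | None, None => True
  | Some C, Some C' => sim n C C'
  | _, _ => False
  end.

(* P(0) = one 0-block (1 block); P(e_i) = 0,0,1,..,i-1 (i+1 blocks,       *)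
(* also for i = 1); P(bar e_i) = 0,0,1,..,n,n-1,..,i (2n+2-i blocks,      *)
(* also for i = n).                                                       *)

Definition P_e (n i : nat) : nat := i.+1.
Definition P_ebar (n i : nat) : nat := ((2 * n).+2 - i)%N.
Definition P_0 : nat := 1.

(* the list of P(u) over the unit pieces u of b (with multiplicity):
   writing b = u + u' with u, u' of total sum 1 amounts to choosing the
   two unit pieces of b; we take them in this list order *)
Definition pieces n (b : Bt n) : seq nat :=
  flatten [seq nseq (bx b i) (P_e n i) | i <- iota 1 n] ++
  flatten [seq nseq (bxb b i) (P_ebar n i) | i <- iota 1 n].

Definition Players n (b : Bt n) : nat * nat :=
  match pieces b with
  | [:: p; q] => (p, q)
  | _ => (P_0, P_0)          (* b = 0 : u = u' = 0 *)
  end.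

Definition arrange (n : nat) (pq : nat * nat) : slice :=
  let p := pq.1 in let q := pq.2 in let D := per n in
  let cands := [:: (p, q); (q, p); (p, q + D); (q, p + D);
                   (p + D, q); (q + D, p)] in
  if [seq C <- cands | isSlice n C] is C :: _ then C else (p, q).

Definition Phi n (b : Bt n) : slice := arrange n (Players b).

(* Main.v *)
(* Every slice is equivalent to exactly one canonical slice: either [(1, 1)]  *)
(* or [(p, q)] with [2 <= p <= q <= 2n+1] blocks in the two layers, and [Phi] *)
(* sends the element with unit pieces of heights [p <= q] to [(p, q)].  In    *)
(* these coordinates [f_i] (resp. [e_i]) raises (resp. lowers) one height by  *)
(* one on both sides, except for [i = 0], where blocks cross the [delta]      *)
(* boundary; so the two crystal structures are compared case by case on       *)
(* which of [p], [q] are the two [i]-slots, [i+1] and [2n+1-i].               *)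

Require Import Defs.
From mathcomp Require Import all_boot all_algebra.
From mathcomp Require Import zify.
Set Implicit Arguments. Unset Strict Implicit. Unset Printing Implicit Defensive.
Import GRing.Theory Num.Theory.

(** The columns P(e_i) and P(bar e_i) have i+1 and 2n+2-i blocks, so together they take each height
    from 2 to [per n] = 2n+1 exactly once. A nonzero element of B is a multiset of two unit pieces,
    hence a pair of heights p <= q in this range ([inB_mkP]), and such a pair is already a level-1
    slice ([Phi_mk]); the zero element gives (1, 1). These pairs form a system of representatives of
    the slices modulo delta: existence is [slice_sim_canon], by removing deltas and using the parity
    of the number of 0-blocks, and uniqueness is [canon_sim_eq]. Hence [Phi] is bijective.

    For 0 < i < n the two i-slots are i+1 (supporting) and 2n+1-i (covering), so an i-block added
    there is the move x_i to x_(i+1), or bar x_(i+1) to bar x_i. The crystal rule compares x_(i+1)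
    with bar x_(i+1). If some piece is bar e_(i+1), then either the other one is e_(i+1), the
    operator vanishes and an (i+1)-block can be split ([canSplitE]), or the covering slot wins;
    otherwise only the supporting slot is active. This is the slice rule. The operators [e_i] are
    treated alike. For i = n the two slots coincide, and for i = 0 the result is compared after a
    shift by one or two deltas. Since the string lengths and the weight are defined through the
    operators, commuting with them is the whole crystal condition. *)

Section Pattern.

Variable n : nat.
Hypothesis hn : 2 <= n.

(** * Colours, slots and splittings within one period of the pattern *)

Lemma color_addper k : color n (k + per n) = color n k.
Proof. by rewrite /color modnDr. Qed.

Lemma color_small k : k < per n ->
  color n k = if k <= 1 then 0 else if k <= n.+1 then k.-1 else per n - k.
Proof. by move=> hk; rewrite /color modn_small. Qed.

Lemma color1 : color n 1 = 0.
Proof. by rewrite color_small // /per; lia. Qed.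

Lemma color_per : color n (per n) = 0.
Proof. by rewrite -[per n]add0n color_addper color_small // /per; lia. Qed.

Lemma color_perS : color n (per n).+1 = 0.
Proof. by rewrite -[_.+1]/(1 + per n) color_addper color_small // /per; lia. Qed.

Lemma nzeroS k : nzero n k.+1 = nzero n k + (color n k == 0).
Proof. by rewrite /nzero -addn1 iotaD count_cat /= addn0. Qed.

Lemma nzero_small k : k <= per n -> nzero n k = minn k 2.
Proof.
elim: k => [|k IH] hk //; rewrite nzeroS IH ?(ltnW hk) // color_small //.
rewrite /per in hk *.
by case: ifP => ?; [|case: ifP => ?]; lia.
Qed.

Lemma nzero_addper k : nzero n (k + per n) = (nzero n k).+2.
Proof.
elim: k => [|k IH]; last by rewrite addSn !nzeroS IH color_addper.
by rewrite add0n !nzero_small // /per; lia.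
Qed.

(** Each colour 0 < i < n occurs once on the way up and once on the way down; for i = n the two
    heights coincide. At height [per n] the slot wraps around to a 0-position. *)
Lemma slotIsE k i : 2 <= k <= per n -> 0 < i <= n ->
  slotIs n k i = (k == i.+1) || (k == (2 * n).+1 - i).
Proof.
move=> hk hi; rewrite /slotIs.
have [->|hne] := eqVneq k (per n); first by rewrite color_per /per; lia.
rewrite color_small; last by lia.
by rewrite /per in hk hne *; do 2?case: ifP => ?; lia.
Qed.

Lemma slotIs0 k : 2 <= k <= per n -> slotIs n k 0 = (k == per n).
Proof.
move=> hk; rewrite /slotIs; have [->|hne] := eqVneq k (per n).
  by rewrite color_per.
rewrite color_small; last by lia.
by rewrite /per in hk hne *; do 2?case: ifP => ?; lia.
Qed.

Lemma topIsE k i : 2 <= k <= per n -> 0 < i <= n ->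
  topIs n k i = (k == i.+2) || (k == (2 * n).+2 - i).
Proof.
move=> hk hi; rewrite /topIs color_small; last by lia.
by rewrite /per in hk *; do 2?case: ifP => ?; lia.
Qed.

Lemma topIs0 k : 2 <= k <= per n -> topIs n k 0 = (k == 2).
Proof.
move=> hk; rewrite /topIs color_small; last by lia.
by rewrite /per in hk *; do 2?case: ifP => ?; lia.
Qed.

Lemma supportingE k : k <= per n -> supporting n k = (2 <= k <= n.+1).
Proof.
move=> hk; rewrite /supporting; have [->|hne] := eqVneq k (per n).
  by rewrite modnn /per; lia.
by rewrite modn_small //; lia.
Qed.

Lemma coveringE k : k <= per n -> covering n k = (k <= 1) || (n.+1 <= k).
Proof.
move=> hk; rewrite /covering; have [->|hne] := eqVneq k (per n).
  by rewrite modnn /per; lia.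
by rewrite modn_small //; lia.
Qed.

(** The block below a supporting j-slot is automatically a (j-1)-block, so only the two heights
    matter: those of P(bar e_j) and P(e_j). *)
Lemma splitABE j k l : 2 <= k <= per n -> 2 <= l <= per n -> 0 < j <= n ->
  splitAB n j k l = (k == (2 * n).+2 - j) && (l == j.+1).
Proof.
move=> hk hl hj; rewrite /splitAB.
have hn' : 0 < n <= n by lia.
have [hjn|hjn] := ltnP j n; last first.
  have -> : j = n by lia.
  rewrite eqxx andbF topIsE // slotIsE //.
  by rewrite /per in hk hl; have [|] := eqVneq k n.+2; lia.
rewrite (topIsE hk) // slotIsE // coveringE ?supportingE; try lia.
have -> /= : 0 < j by lia.
rewrite /per in hk hl.
have [hlj|hlj] := eqVneq l j.+1; last first.
  by have [hl2|hl2] := ltnP n.+1 l; lia.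
have -> : topIs n l j.-1.
  rewrite hlj; case: j hj {hjn hlj} => [|[|j]] hj //.
  - by rewrite topIs0 // /per; lia.
  - by rewrite topIsE ?eqxx // /per; lia.
by lia.
Qed.

(** In terms of B, a j-block splits exactly for the element e_j + bar e_j, on which the operators of
    index j-1 vanish. The order p <= q rules out the mirrored splitting. *)
Lemma canSplitE p q j : 2 <= p -> p <= q -> q <= per n -> 0 < j <= n ->
  canSplit n (p, q) j = (p == j.+1) && (q == (2 * n).+2 - j).
Proof.
by move=> hp hpq hq hj; rewrite /canSplit !splitABE //=; lia.
Qed.

Lemma isSlice_canon p q : 2 <= p -> p <= q -> q <= per n -> isSlice n (p, q).
Proof.
by move=> hp hpq hq; rewrite /isSlice /= !nzero_small //=; lia.
Qed.

Lemma isSlice11 : isSlice n (1, 1).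
Proof. by apply/and3P; split; rewrite ?addnn ?odd_double // /per; lia. Qed.

Lemma chk_canon p q : 2 <= p -> p <= q -> q <= per n -> chk n (p, q) = Some (p, q).
Proof. by move=> *; rewrite /chk isSlice_canon. Qed.

(** * Slices modulo delta and their canonical representatives *)

(** A delta contains two 0-blocks, so parity is kept, and the two containments trade places. *)
Lemma isSlice_plusd C : isSlice n (plusd n C) = isSlice n C.
Proof.
case: C => a c; rewrite /isSlice /plusd /= nzero_addper leq_add2r.
by rewrite !addnS /= negbK [nzero n c + _]addnC andbCA.
Qed.

Lemma plusd_inj : injective (plusd n).
Proof. by case=> a c [a' c'] [-> /eqP]; rewrite eqn_add2r => /eqP ->. Qed.

Lemma sim_refl C : sim n C C.
Proof. by exists 0; left. Qed.

Lemma sim_sym C D : sim n C D -> sim n D C.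
Proof. by case=> m [<-|<-]; exists m; [right|left]. Qed.

Lemma sim_plusd C : sim n C (plusd n C).
Proof. by exists 1; left. Qed.

(** Chains of deltas in opposite directions are cancelled by injectivity of [plusd]. *)
Lemma sim_trans C D E : sim n C D -> sim n D E -> sim n C E.
Proof.
have inj m : injective (iter m (plusd n)).
  by elim: m => [|m IH] x y //= /plusd_inj/IH.
move=> [m [<-|<-]] [m' [<-|]].
- by exists (m' + m); left; rewrite iterD.
- move=> h; have [hle|hlt] := leqP m m'.
    exists (m' - m); right; apply: (inj m).
    by rewrite -iterD subnKC.
  exists (m - m'); left; apply: (inj m').
  by rewrite -iterD subnKC // ltnW.
- have [hle|hlt] := leqP m m'.
    by exists (m' - m); left; rewrite -iterD subnK.
  by exists (m - m'); right; rewrite -iterD subnK // ltnW.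
- by move=> <-; exists (m + m'); right; rewrite iterD.
Qed.

Definition canon (C : slice) : bool :=
  (C == (1, 1)) || [&& 2 <= C.1, C.1 <= C.2 & C.2 <= per n].

Lemma canon_sim_eq C D : canon C -> canon D -> sim n C D -> C = D.
Proof.
suff main C' D' m : canon C' -> canon D' -> iter m (plusd n) C' = D' -> C' = D'.
  move=> hC hD [m [h|h]]; first exact: main h.
  by apply/esym; exact: main h.
case: m => [//|m] hC hD h.
(* Both layers stay nonempty, so after at least one shift the second layer exceeds [per n] and
   cannot be canonical. *)
have pos k : 0 < (iter k (plusd n) C').1 /\ 0 < (iter k (plusd n) C').2.
  elim: k => [|k [IH1 IH2]] /=; last by rewrite addnS; split.
  by case/orP: hC => [/eqP -> //|]; lia.
have := pos m; move: hD; rewrite -h /= /canon /plusd /=.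
case: (iter m _ _) => a c /=; rewrite xpair_eqE /per; lia.
Qed.

Lemma slice_sim_canon C : isSlice n C -> exists2 D, canon D & sim n D C.
Proof.
have [k] := ubnP (C.1 + C.2); elim: k C => [//|k IH] [a c] /= hk hC.
have [hlt|hle] := ltnP (per n) c.
  have e : (a, c) = plusd n (c - per n, a) by rewrite /plusd /= subnK // ltnW.
  have [||D hD hs] := IH (c - per n, a); first by rewrite /= /per in hlt *; lia.
    by rewrite -isSlice_plusd // -e.
  by exists D => //; apply: sim_trans hs _; rewrite e; apply: sim_plusd.
case/and3P: (hC) => /= hac _; rewrite !nzero_small; try lia.
(* With both layers at most one delta high, only a first layer with 0 or 1 blocks fails to be
   canonical; parity then excludes (0, 1) and leaves (1, 1) when a = 1. *)
case: a hac hk hC => [|[|a]] hac hk hC hodd.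
- have [->|hc] := posnP c.
    exists (per n, per n); first by rewrite /canon /= /per; lia.
    by apply: sim_sym; exists 2; left.
  have hc1 : c != 1 by apply: contraL hodd => /eqP ->.
  exists (c, per n); first by rewrite /canon /=; lia.
  by apply/sim_sym; apply: (sim_plusd (0, c)).
- exists (1, 1) => //; have -> : c = 1.
    apply/eqP; apply: contraNT hodd => hc.
    by rewrite (_ : minn c 2 = 2) //; lia.
  exact: sim_refl.
- exists (a.+2, c); last exact: sim_refl.
  by rewrite /canon /=; lia.
Qed.

End Pattern.

Section Crystal.

Variable n : nat.
Hypothesis hn : 2 <= n.

Implicit Type b : Bt n.

(** * Elements of B as multisets of unit pieces *)

Lemma getcS (f : {ffun 'I_n -> nat}) (j : 'I_n) : getc f j.+1 = f j.
Proof. by rewrite /getc valK. Qed.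

Lemma piecesE b : pieces b =
  flatten [seq nseq (b.1 j) j.+2 | j : 'I_n <- enum 'I_n] ++
  flatten [seq nseq (b.2 j) ((2 * n).+1 - j) | j : 'I_n <- enum 'I_n].
Proof.
have -> : pieces b =
    flatten [seq nseq (bx b i) (P_e n i) | i <- [seq (j : 'I_n).+1 | j <- enum 'I_n]] ++
    flatten [seq nseq (bxb b i) (P_ebar n i) | i <- [seq (j : 'I_n).+1 | j <- enum 'I_n]].
  rewrite /pieces (_ : [seq _ | j <- _] = iota 1 n) //.
  by rewrite (map_comp succn) val_enum_ord (iotaDl 1 0).
rewrite -!map_comp.
by congr (flatten _ ++ flatten _); apply: eq_map => j;
   rewrite [LHS]/(comp _ _ _) /bx /bxb getcS.
Qed.

Lemma totsumE b : totsum b = \sum_j (b.1 j + b.2 j).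
Proof. by rewrite /totsum sumnE big_map big_enum. Qed.

Lemma size_pieces b : size (pieces b) = totsum b.
Proof.
rewrite piecesE size_cat /totsum.
elim: (enum _) => //= j s IH; rewrite !size_cat !size_nseq -IH; lia.
Qed.

Lemma count_flatten_nseq (T : eqType) (f : T -> nat) (g : T -> nat) s k :
  count_mem k (flatten [seq nseq (f j) (g j) | j <- s]) =
  \sum_(j <- s) f j * (g j == k).
Proof.
by elim: s => [|j s IH]; rewrite ?big_nil // big_cons /= count_cat IH count_nseq mulnC.
Qed.

Lemma count_pieces b k : count_mem k (pieces b) =
  \sum_j (b.1 j * (j.+2 == k) + b.2 j * ((2 * n).+1 - j == k)).
Proof.
by rewrite piecesE count_cat !count_flatten_nseq -big_split big_enum.
Qed.

(** Unbarred heights are at most n+1 and barred ones at least n+2, so each multiplicity in the list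
    is a single coordinate of [b]. *)
Lemma count_pieces_x b (j : 'I_n) : count_mem j.+2 (pieces b) = b.1 j.
Proof.
rewrite count_pieces (bigD1 j) //= big1 => [|i /eqP hij].
  by rewrite eqxx; have := ltn_ord j; lia.
have : i <> j :> nat by move/val_inj.
by have := ltn_ord j; have := ltn_ord i; lia.
Qed.

Lemma count_pieces_xb b (j : 'I_n) : count_mem ((2 * n).+1 - j) (pieces b) = b.2 j.
Proof.
rewrite count_pieces (bigD1 j) //= big1 => [|i /eqP hij].
  by rewrite eqxx; have := ltn_ord j; lia.
have : i <> j :> nat by move/val_inj.
by have := ltn_ord j; have := ltn_ord i; lia.
Qed.

Lemma pieces_range b k : k \in pieces b -> 2 <= k <= per n.
Proof.
rewrite -has_pred1 has_count count_pieces lt0n sum_nat_eq0 negb_forall.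
by case/existsP=> j; have := ltn_ord j; rewrite /per; lia.
Qed.

Lemma pieces_inj : injective (@pieces n).
Proof.
move=> [f g] [f' g'] h; congr (_, _); apply/ffunP => j.
  by rewrite -[f j]/((f, g).1 j) -count_pieces_x h count_pieces_x.
by rewrite -[g j]/((f, g).2 j) -count_pieces_xb h count_pieces_xb.
Qed.

(* [p = q = 1] encodes the zero element, since no unit piece has height 1. *)
Definition mk p q : Bt n :=
  ([ffun j : 'I_n => (p == j.+2) + (q == j.+2)],
   [ffun j : 'I_n => (p == (2 * n).+1 - j) + (q == (2 * n).+1 - j)]).

Lemma mkC p q : mk p q = mk q p.
Proof. by congr (_, _); apply/ffunP => j; rewrite !ffunE addnC. Qed.

Lemma perm_pieces_mk p q : 2 <= p <= per n -> 2 <= q <= per n ->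
  perm_eq (pieces (mk p q)) [:: p; q].
Proof.
move=> hp hq; apply/allP => k; rewrite mem_cat => hk.
have {hk} hk : 2 <= k <= per n.
  by case/orP: hk => [/pieces_range //|]; rewrite !inE => /orP[]/eqP ->.
apply/eqP; rewrite [RHS]/= addn0; have [hkn|hkn] := leqP k n.+1.
  have hj : k.-2 < n by lia.
  have -> : k = (Ordinal hj).+2 by rewrite /=; lia.
  by rewrite count_pieces_x ffunE.
have hj : (2 * n).+1 - k < n by lia.
have -> : k = (2 * n).+1 - Ordinal hj by rewrite /= /per in hk *; lia.
by rewrite count_pieces_xb ffunE.
Qed.

Lemma totsum_mk p q : 2 <= p <= per n -> 2 <= q <= per n -> totsum (mk p q) = 2.
Proof. by move=> hp hq; rewrite -size_pieces (perm_size (perm_pieces_mk hp hq)). Qed.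

Lemma inB_mk p q : 2 <= p <= per n -> 2 <= q <= per n -> inB (mk p q).
Proof. by move=> hp hq; rewrite /inB totsum_mk. Qed.

Lemma pieces_mk11 : pieces (mk 1 1) = [::].
Proof.
apply: size0nil; rewrite size_pieces /totsum; apply/eqP.
elim: (enum _) => //= j s; rewrite !ffunE; have := ltn_ord j; lia.
Qed.

Lemma inB_mk11 : inB (mk 1 1).
Proof. by rewrite /inB -size_pieces pieces_mk11. Qed.

Lemma Phi_mk11 : Phi (mk 1 1) = (1, 1).
Proof.
by rewrite /Phi /Players pieces_mk11 /arrange /=.
Qed.

(** Both columns contain two 0-blocks and differ by less than a delta, so sorting them suffices and
    no delta is added. *)
Lemma arrangeE p q : 2 <= p <= per n -> 2 <= q <= per n ->
  arrange n (p, q) = (minn p q, maxn p q).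
Proof.
move=> hp hq; rewrite /arrange /=; have [hpq|hqp] := leqP p q.
  by rewrite isSlice_canon //; lia.
by rewrite {1}/isSlice /= leqNgt hqp /= isSlice_canon //; lia.
Qed.

Lemma Phi_mk p q : 2 <= p -> p <= q -> q <= per n -> Phi (mk p q) = (p, q).
Proof.
move=> hp hpq hq; have hp' : 2 <= p <= per n by lia.
have hq' : 2 <= q <= per n by lia.
have h := perm_pieces_mk hp' hq'; rewrite /Phi /Players.
case: (pieces _) h (perm_size h) => [|p' [|q' [|? ?]]] // h _.
have /orP[] : (p' == p) && (q' == q) || (p' == q) && (q' == p).
  have := permP h (pred1 p); have := permP h (pred1 q); rewrite /= !eqxx; lia.
  by move=> /andP[/eqP -> /eqP ->]; rewrite arrangeE //; congr (_, _); lia.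
by move=> /andP[/eqP -> /eqP ->]; rewrite arrangeE //; congr (_, _); lia.
Qed.

Lemma inB_mkP b : inB b ->
  b = mk 1 1 \/ exists p q, [/\ 2 <= p, p <= q, q <= per n & b = mk p q].
Proof.
rewrite /inB -size_pieces => /orP[/eqP/size0nil h|hs].
  by left; apply: pieces_inj; rewrite h pieces_mk11.
right; have hr := @pieces_range b.
case E: (pieces b) hs hr => [|p [|q [|? ?]]] // _ hr.
have hp : 2 <= p <= per n by apply: hr; rewrite !inE eqxx.
have hq : 2 <= q <= per n by apply: hr; rewrite !inE eqxx orbT.
have -> : b = mk p q.
  have -> : b = (b.1, b.2) by case: (b).
  congr (_, _); apply/ffunP => j; rewrite ffunE.
    by rewrite -count_pieces_x E /= addn0.
  by rewrite -count_pieces_xb E /= addn0.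
have [hpq|hpq] := leqP p q; first by exists p, q; split=> //; lia.
by exists q, p; rewrite mkC; split=> //; lia.
Qed.

Lemma bx_mk p q i : 0 < i <= n -> bx (mk p q) i = (p == i.+1) + (q == i.+1).
Proof.
case: i => // i hi; have hj : i < n by lia.
by rewrite /bx -[i]/(val (Ordinal hj)) getcS ffunE.
Qed.

Lemma bxb_mk p q i : 0 < i <= n ->
  bxb (mk p q) i = (p == (2 * n).+2 - i) + (q == (2 * n).+2 - i).
Proof.
case: i => // i hi; have hj : i < n by lia.
by rewrite /bxb -[i]/(val (Ordinal hj)) getcS ffunE subSS.
Qed.

(** * The crystal operators of B in terms of heights *)

Lemma shiftB_some b b' (dx dxb : nat -> int) :
  (forall j : 'I_n, (b.1 j)%:Z + dx j.+1 = (b'.1 j)%:Z)%R ->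
  (forall j : 'I_n, (b.2 j)%:Z + dxb j.+1 = (b'.2 j)%:Z)%R ->
  shiftB b dx dxb = if inB b' then Some b' else None.
Proof.
have add (f f' : {ffun 'I_n -> nat}) d :
    (forall j : 'I_n, (f j)%:Z + d j.+1 = (f' j)%:Z)%R -> Defs.addv f d = Some f'.
  move=> h; rewrite /Defs.addv; case: forallP => [_|[]] => [|j]; last by rewrite h.
  by congr Some; apply/ffunP => j; rewrite ffunE h.
move=> h1 h2; rewrite /shiftB (add _ _ _ h1) (add _ _ _ h2).
by case: b' {h1 h2}.
Qed.

Lemma shiftB_none b (dx dxb : nat -> int) (j : 'I_n) :
  ((b.1 j)%:Z + dx j.+1 < 0)%R || ((b.2 j)%:Z + dxb j.+1 < 0)%R ->
  shiftB b dx dxb = None.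
Proof.
rewrite /shiftB /Defs.addv => /orP[] h; case: forallP => [/(_ j)|_] //.
- lia.
- by case: forallP => [/(_ j)|_] //; lia.
Qed.

(* Every operator [f_i], [e_i] with unit increments slides a single piece of *)
(* [b] from one height [a] to another height [c].                            *)
Lemma shiftB_move p q a c (dx dxb : nat -> int) :
  2 <= p <= per n -> 2 <= q <= per n ->
  2 <= a <= per n -> 2 <= c <= per n -> a != c ->
  (forall j : 'I_n, dx j.+1 = (c == j.+2)%:Z - (a == j.+2)%:Z)%R ->
  (forall j : 'I_n,
     dxb j.+1 = (c == ((2 * n).+1 - j)%N)%:Z - (a == ((2 * n).+1 - j)%N)%:Z)%R ->
  shiftB (mk p q) dx dxb =
    if p == a then Some (mk c q) else if q == a then Some (mk p c) else None.
Proof.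
move=> hp hq ha hc hac hdx hdxb.
case: eqP => [->|hpa].
  rewrite (@shiftB_some _ (mk c q)) ?inB_mk // => j; rewrite /= !ffunE ?hdx ?hdxb; lia.
case: eqP => [->|hqa].
  rewrite (@shiftB_some _ (mk p c)) ?inB_mk // => j; rewrite /= !ffunE ?hdx ?hdxb; lia.
have [han|han] := leqP a n.+1.
  have hj : a.-2 < n by lia.
  apply: (@shiftB_none _ _ _ (Ordinal hj)); apply/orP; left.
  by rewrite hdx /= !ffunE /=; lia.
have hj : (2 * n).+1 - a < n by lia.
apply: (@shiftB_none _ _ _ (Ordinal hj)); apply/orP; right.
rewrite hdxb /= !ffunE /=.
by rewrite /per in ha hc; lia.
Qed.

(** The total would exceed 2, which leaves B; this disposes of adding 2 to x_1 or to bar x_1 when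
    the element is nonzero. *)
Lemma shiftB_overflow b (dx dxb : nat -> int) (j0 : 'I_n) : totsum b = 2 ->
  (forall j : 'I_n, 0 <= dx j.+1)%R -> (forall j : 'I_n, 0 <= dxb j.+1)%R ->
  (0 < dx j0.+1 + dxb j0.+1)%R -> shiftB b dx dxb = None.
Proof.
move=> hb hx hxb h0.
pose b' : Bt n := ([ffun j : 'I_n => absz ((b.1 j)%:Z + dx j.+1)%R],
                   [ffun j : 'I_n => absz ((b.2 j)%:Z + dxb j.+1)%R]).
rewrite (@shiftB_some _ b'); last 2 first.
- by move=> j; rewrite ffunE; have := hx j; lia.
- by move=> j; rewrite ffunE; have := hxb j; lia.
suff hlt : totsum b < totsum b' by rewrite /inB; case: ifP => //; lia.
rewrite !totsumE (bigD1 j0) //= [ltnRHS](bigD1 j0) //=.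
rewrite !ffunE -addSn leq_add //; first by have := hx j0; have := hxb j0; lia.
apply: leq_sum => j _; rewrite !ffunE; have := hx j; have := hxb j; lia.
Qed.

Ltac shift_coords :=
  move=> j; have := ltn_ord j; rewrite /vadd /uvec /vzero /per;
  do ?[case: ifP => ?]; lia.

Lemma fB_mk p q i : 2 <= p <= per n -> 2 <= q <= per n -> 0 < i < n ->
  fB i (mk p q) =
  if (p == (2 * n).+1 - i) + (q == (2 * n).+1 - i) <= (p == i.+2) + (q == i.+2)
  then if p == i.+1 then Some (mk i.+2 q)
       else if q == i.+1 then Some (mk p i.+2) else None
  else if p == (2 * n).+1 - i then Some (mk ((2 * n).+2 - i) q)
       else if q == (2 * n).+1 - i then Some (mk p ((2 * n).+2 - i)) else None.
Proof.
move=> hp hq hi; have hi1 : 0 < i.+1 <= n by lia.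
rewrite /fB (bx_mk _ _ hi1) (bxb_mk _ _ hi1) ifN; last by lia.
rewrite ifT ?subSS; last by lia.
case: ifP => _; apply: shiftB_move; rewrite // /per; try lia; shift_coords.
Qed.

Lemma eB_mk p q i : 2 <= p <= per n -> 2 <= q <= per n -> 0 < i < n ->
  eB i (mk p q) =
  if (p == (2 * n).+1 - i) + (q == (2 * n).+1 - i) < (p == i.+2) + (q == i.+2)
  then if p == i.+2 then Some (mk i.+1 q)
       else if q == i.+2 then Some (mk p i.+1) else None
  else if p == (2 * n).+2 - i then Some (mk ((2 * n).+1 - i) q)
       else if q == (2 * n).+2 - i then Some (mk p ((2 * n).+1 - i)) else None.
Proof.
move=> hp hq hi; have hi1 : 0 < i.+1 <= n by lia.
rewrite /eB (bx_mk _ _ hi1) (bxb_mk _ _ hi1) ifN; last by lia.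
rewrite ifT ?subSS; last by lia.
case: ifP => _; apply: shiftB_move; rewrite // /per; try lia; shift_coords.
Qed.

Lemma fBn_mk p q : 2 <= p <= per n -> 2 <= q <= per n ->
  fB n (mk p q) = if p == n.+1 then Some (mk n.+2 q)
                  else if q == n.+1 then Some (mk p n.+2) else None.
Proof.
move=> hp hq; rewrite /fB ltnn eqxx ifN; last by lia.
apply: shiftB_move; rewrite // /per; try lia; shift_coords.
Qed.

Lemma eBn_mk p q : 2 <= p <= per n -> 2 <= q <= per n ->
  eB n (mk p q) = if p == n.+2 then Some (mk n.+1 q)
                  else if q == n.+2 then Some (mk p n.+1) else None.
Proof.
move=> hp hq; rewrite /eB ltnn eqxx ifN; last by lia.
apply: shiftB_move; rewrite // /per; try lia; shift_coords.
Qed.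

Lemma fB0_mk p q : 2 <= p -> p <= q -> q <= per n ->
  fB 0 (mk p q) =
  if (p != 2) && (q == per n)
  then Some (if p == per n then mk 1 1 else mk 2 p) else None.
Proof.
move=> hp hpq hq; have hn1 : 0 < 1 <= n by lia.
rewrite /fB eqxx (bx_mk _ _ hn1) (bxb_mk _ _ hn1).
have hp' : 2 <= p <= per n by lia.
have hq' : 2 <= q <= per n by lia.
rewrite subn1 -[(2 * n).+2.-1]/(per n).
case: ifP => h1.
  rewrite (@shiftB_overflow _ _ _ (Ordinal (ltnW hn))) ?totsum_mk //.
  - by rewrite /per in h1 hq *; rewrite ifN //; lia.
  - shift_coords.
case: ifP => h2.
  (* Here bar x_1 = 1 and x_1 = 0: the piece bar e_1 becomes e_1, that is, height [per n] drops to
     2. *)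
  rewrite (@shiftB_move p q (per n) 2) // /per; try lia; try shift_coords.
  have [hp2 hpn ->] : [/\ p != 2, p != per n & q = per n].
    by rewrite /per in h1 h2 hq *; split; lia.
  by rewrite hp2 (negbTE hpn) eqxx mkC.
have [-> ->] : p = per n /\ q = per n by rewrite /per in h1 h2 hq *; lia.
rewrite (@shiftB_some _ (mk 1 1)) ?inB_mk11.
- by rewrite eqxx ifT // /per; lia.
- by move=> j; rewrite !ffunE; move: j; shift_coords.
- by move=> j; rewrite !ffunE; move: j; shift_coords.
Qed.

Lemma eB0_mk p q : 2 <= p -> p <= q -> q <= per n ->
  eB 0 (mk p q) =
  if (p == 2) && (q != per n)
  then Some (if q == 2 then mk 1 1 else mk q (per n)) else None.
Proof.
move=> hp hpq hq; have hn1 : 0 < 1 <= n by lia.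
rewrite /eB eqxx (bx_mk _ _ hn1) (bxb_mk _ _ hn1).
have hp' : 2 <= p <= per n by lia.
have hq' : 2 <= q <= per n by lia.
rewrite subn1 -[(2 * n).+2.-1]/(per n).
case: ifP => h1.
  have [-> ->] : p = 2 /\ q = 2 by rewrite /per in h1 hq *; lia.
  rewrite (@shiftB_some _ (mk 1 1)) ?inB_mk11.
  - by rewrite eqxx ifT // /per; lia.
  - by move=> j; rewrite !ffunE; move: j; shift_coords.
  - by move=> j; rewrite !ffunE; move: j; shift_coords.
case: ifP => h2.
  rewrite (@shiftB_move p q 2 (per n)) // /per; try lia; try shift_coords.
  have [-> hq2 hqn] : [/\ p = 2, q != 2 & q != per n].
    by rewrite /per in h1 h2 hq *; split; lia.
  by rewrite eqxx (negbTE hqn) (negbTE hq2) mkC.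
rewrite (@shiftB_overflow _ _ _ (Ordinal (ltnW hn))) ?totsum_mk //.
- by rewrite /per in h1 h2 hq *; rewrite ifN //; lia.
- shift_coords.
Qed.

Lemma fB_mk11 i : i <= n -> fB i (mk 1 1) = if i == 0 then Some (mk 2 2) else None.
Proof.
move=> hi; case: (posnP i) => [->|hi0].
  have hn1 : 0 < 1 <= n by lia.
  rewrite /fB eqxx (bx_mk _ _ hn1) (bxb_mk _ _ hn1) ifT; last by lia.
  rewrite (@shiftB_some _ (mk 2 2)) ?inB_mk // /per; try lia.
  - by move=> j; rewrite !ffunE; move: j; shift_coords.
  - by move=> j; rewrite !ffunE; move: j; shift_coords.
have hj : i.-1 < n by lia.
have hi0' : (i == 0) = false by lia.
rewrite /fB hi0'; case: ltnP => hin.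
  have hi1 : 0 < i.+1 <= n by lia.
  rewrite (bx_mk _ _ hi1) (bxb_mk _ _ hi1) ifT; last by lia.
  apply: (@shiftB_none _ _ _ (Ordinal hj)); rewrite /= !ffunE /=.
  by rewrite /vadd /uvec; do ?[case: ifP => ?]; lia.
case: ifP => // _.
apply: (@shiftB_none _ _ _ (Ordinal hj)); rewrite /= !ffunE /=.
by rewrite /vadd /uvec; do ?[case: ifP => ?]; lia.
Qed.

Lemma eB_mk11 i : i <= n ->
  eB i (mk 1 1) = if i == 0 then Some (mk (per n) (per n)) else None.
Proof.
move=> hi; case: (posnP i) => [->|hi0].
  have hn1 : 0 < 1 <= n by lia.
  rewrite /eB eqxx (bx_mk _ _ hn1) (bxb_mk _ _ hn1).
  rewrite (_ : (_ < _) = false); last by lia.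
  rewrite (_ : (_ == _.+1) = false); last by lia.
  rewrite (@shiftB_some _ (mk (per n) (per n))) ?inB_mk // /per; try lia.
  - by move=> j; rewrite !ffunE; move: j; shift_coords.
  - by move=> j; rewrite !ffunE; move: j; shift_coords.
have hj : i.-1 < n by lia.
have hi0' : (i == 0) = false by lia.
rewrite /eB hi0'; case: ltnP => hin.
  have hi1 : 0 < i.+1 <= n by lia.
  rewrite (bx_mk _ _ hi1) (bxb_mk _ _ hi1) (_ : (_ < _) = false); last by lia.
  apply: (@shiftB_none _ _ _ (Ordinal hj)); rewrite /= !ffunE /=.
  by rewrite /vadd /uvec; do ?[case: ifP => ?]; lia.
case: ifP => // _; have hj' : n.-1 < n by lia.
apply: (@shiftB_none _ _ _ (Ordinal hj')); rewrite /= !ffunE /=.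
by rewrite /vadd /uvec; do ?[case: ifP => ?]; lia.
Qed.

(** * Comparison of the two families of operators *)

Lemma osim_mk p q a c : 2 <= a -> a <= c -> c <= per n ->
  (p == a) && (q == c) || (p == c) && (q == a) ->
  osim n (omap (@Phi n) (Some (mk p q))) (chk n (a, c)).
Proof.
move=> ha hac hc /orP[] /andP[/eqP -> /eqP ->]; rewrite /= ?(mkC c);
  rewrite Phi_mk // chk_canon //; exact: sim_refl.
Qed.

(** Splits on every test of both rules; arithmetic refutes the incompatible outcomes, and in the
    others both sides vanish or carry the same pair of heights up to order. *)
Ltac crystal_cases :=
  repeat match goal with
  | |- context [if ?b then _ else _] =>
      let H := fresh in destruct b eqn:H; try (exfalso; lia)
  end;
  try exact: I; try (apply: osim_mk; lia).

Lemma Phi_fB p q i : 2 <= p -> p <= q -> q <= per n -> 0 < i < n ->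
  osim n (omap (@Phi n) (fB i (mk p q))) (fS n i (Phi (mk p q))).
Proof.
move=> hp hpq hq hi.
have hp' : 2 <= p <= per n by lia.
have hq' : 2 <= q <= per n by lia.
have hi0 : (i == 0) = false by lia.
have hin : (i == n) = false by lia.
have hni : (n < i) = false by lia.
have hi1 : 0 < i <= n by lia.
have hi2 : 0 < i.+1 <= n by lia.
rewrite Phi_mk // fB_mk // /fS hi0 hni hin /= canSplitE // !slotIsE //.
rewrite !supportingE ?coveringE //; try lia.
rewrite subSS (_ : (2 * n).+2 - i = ((2 * n).+1 - i).+1); last by lia.
(* Naming the covering slot [t] keeps truncated subtraction out of the case analysis. *)
have [t ht] : exists t, (2 * n).+1 - i = t by eexists.
rewrite ht; have {ht} ht : per n = t + i by rewrite /per; lia.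
have hit : i.+1 < t by rewrite /per in ht; lia.
have hnt : n.+1 < t by rewrite /per in ht; lia.
rewrite ht in hq.
clear hp' hq' hi0 hin hni hi1 hi2.
(* Two slots of the same kind are at the same height, so the height test of the slice rule is
   decided by whether p = q. *)
have [hpq'|hpq'] := eqVneq p q; last by crystal_cases.
by rewrite -hpq' in hpq hq *; rewrite !eqxx /=; crystal_cases.
Qed.

Lemma Phi_eB p q i : 2 <= p -> p <= q -> q <= per n -> 0 < i < n ->
  osim n (omap (@Phi n) (eB i (mk p q))) (eS n i (Phi (mk p q))).
Proof.
move=> hp hpq hq hi.
have hp' : 2 <= p <= per n by lia.
have hq' : 2 <= q <= per n by lia.
have hi0 : (i == 0) = false by lia.
have hin : (i == n) = false by lia.
have hni : (n < i) = false by lia.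
have hi1 : 0 < i <= n by lia.
have hi2 : 0 < i.+1 <= n by lia.
rewrite Phi_mk // eB_mk // /eS hi0 hni hin /= canSplitE // !topIsE //.
rewrite !supportingE //; try lia.
rewrite subSS (_ : (2 * n).+2 - i = ((2 * n).+1 - i).+1); last by lia.
have [t ht] : exists t, (2 * n).+1 - i = t by eexists.
rewrite ht; have {ht} ht : per n = t + i by rewrite /per; lia.
have hit : i.+1 < t by rewrite /per in ht; lia.
have hnt : n.+1 < t by rewrite /per in ht; lia.
rewrite ht in hq.
clear hp' hq' hi0 hin hni hi1 hi2.
have [hpq'|hpq'] := eqVneq p q; last by crystal_cases.
by rewrite -hpq' in hpq hq *; rewrite !eqxx /=; crystal_cases.
Qed.

Lemma Phi_fBn p q : 2 <= p -> p <= q -> q <= per n ->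
  osim n (omap (@Phi n) (fB n (mk p q))) (fS n n (Phi (mk p q))).
Proof.
move=> hp hpq hq.
have hp' : 2 <= p <= per n by lia.
have hq' : 2 <= q <= per n by lia.
have hn0 : (n == 0) = false by lia.
have hnn : 0 < n <= n by lia.
rewrite Phi_mk // fBn_mk // /fS hn0 ltnn eqxx /= !slotIsE //.
rewrite (_ : (2 * n).+1 - n = n.+1); last by lia.
have hper : n.+2 <= per n by rewrite /per; lia.
have [hpq'|hpq'] := eqVneq p q; last by crystal_cases.
by rewrite -hpq' in hpq hq *; rewrite !eqxx /=; crystal_cases.
Qed.

Lemma Phi_eBn p q : 2 <= p -> p <= q -> q <= per n ->
  osim n (omap (@Phi n) (eB n (mk p q))) (eS n n (Phi (mk p q))).
Proof.
move=> hp hpq hq.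
have hp' : 2 <= p <= per n by lia.
have hq' : 2 <= q <= per n by lia.
have hn0 : (n == 0) = false by lia.
have hnn : 0 < n <= n by lia.
rewrite Phi_mk // eBn_mk // /eS hn0 ltnn eqxx /= !topIsE //.
rewrite (_ : (2 * n).+2 - n = n.+2); last by lia.
have hper : n.+2 <= per n by rewrite /per; lia.
have [hpq'|hpq'] := eqVneq p q; last by crystal_cases.
by rewrite -hpq' in hpq hq *; rewrite !eqxx /=; crystal_cases.
Qed.

Lemma osim_chk_plusd C D : isSlice n C -> D = plusd n C ->
  osim n (Some C) (chk n D).
Proof.
by move=> hC ->; rewrite /chk isSlice_plusd // hC; apply: sim_plusd.
Qed.

Lemma osim_chk_plusd_sym C D : isSlice n C -> C = plusd n D ->
  osim n (Some C) (chk n D).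
Proof.
move=> hC e; rewrite /chk -isSlice_plusd // -e hC e.
exact/sim_sym/sim_plusd.
Qed.

Lemma Phi_fB0 p q : 2 <= p -> p <= q -> q <= per n ->
  osim n (omap (@Phi n) (fB 0 (mk p q))) (fS n 0 (Phi (mk p q))).
Proof.
move=> hp hpq hq.
have hp' : 2 <= p <= per n by lia.
have hq' : 2 <= q <= per n by lia.
have hn1 : 0 < 1 <= n by lia.
rewrite Phi_mk // fB0_mk // /fS eqxx canSplitE // subn1 /= -/(per n) !slotIs0 //.
have [->|hqn] := eqVneq q (per n); last first.
  by rewrite !andbF (_ : (p == per n) = false) //; lia.
have [->|hp2] //= := eqVneq p 2; have [->|hpn] := eqVneq p (per n).
  (* Adding a 0-block to both full columns gives (1, 1) shifted by two deltas. *)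
  rewrite /= Phi_mk11 (_ : ((per n).+1, _) = iter 2 (plusd n) (1, 1)) //.
  by rewrite /chk !isSlice_plusd // isSlice11; exists 2; left.
rewrite /= /add2z color_per // color_perS //= Phi_mk //; try lia.
apply: osim_chk_plusd; first by apply: isSlice_canon; lia.
by rewrite /plusd /= add2n.
Qed.

Lemma Phi_eB0 p q : 2 <= p -> p <= q -> q <= per n ->
  osim n (omap (@Phi n) (eB 0 (mk p q))) (eS n 0 (Phi (mk p q))).
Proof.
move=> hp hpq hq.
have hp' : 2 <= p <= per n by lia.
have hq' : 2 <= q <= per n by lia.
have hn1 : 0 < 1 <= n by lia.
rewrite Phi_mk // eB0_mk // /eS eqxx canSplitE // subn1 /= -/(per n) !topIs0 //.
have [->|hp2] /= := eqVneq p 2; last first.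
  by rewrite (_ : (q == 2) = false) //; lia.
have [->|hqn] //= := eqVneq q (per n); have [->|hq2] := eqVneq q 2.
  by rewrite Phi_mk11 [chk _ _]/chk (_ : isSlice n _); [apply: sim_refl | apply: isSlice11].
have c0 : color n 0 = 0 by rewrite color_small.
rewrite /= /rem2z /= color1 // c0 /= Phi_mk //; try lia.
(* Removing both 0-blocks leaves (0, q), and one delta turns it into (q, [per n]). *)
apply: osim_chk_plusd_sym; last by [].
by apply: isSlice_canon; lia.
Qed.

Lemma slotIs11 i : slotIs n 1 i = (i == 0).
Proof. by rewrite /slotIs color1 // eq_sym. Qed.

Lemma topIs11 i : topIs n 1 i = (i == 0).
Proof. by rewrite /topIs /= color_small // eq_sym. Qed.

Lemma canSplit11 : canSplit n (1, 1) 1 = false.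
Proof.
have h : splitAB n 1 1 1 = false by rewrite /splitAB hn !topIs11.
by rewrite /canSplit h.
Qed.

Lemma Phi_fB_mk11 i : i <= n ->
  osim n (omap (@Phi n) (fB i (mk 1 1))) (fS n i (Phi (mk 1 1))).
Proof.
move=> hi; rewrite fB_mk11 // Phi_mk11 /fS /= !slotIs11.
case: posnP => [_|_] /=; last by rewrite ltnNge hi /=; case: ifP.
rewrite canSplit11 /=.
by apply: osim_mk; rewrite // /per; lia.
Qed.

Lemma Phi_eB_mk11 i : i <= n ->
  osim n (omap (@Phi n) (eB i (mk 1 1))) (eS n i (Phi (mk 1 1))).
Proof.
move=> hi; rewrite eB_mk11 // Phi_mk11 /eS /= !topIs11.
case: posnP => [_|_] /=; last by rewrite ltnNge hi /=; case: ifP.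
rewrite canSplit11 /= Phi_mk //; last by rewrite /per; lia.
rewrite /chk /isSlice /=.
(* The slice side is the empty slice (0, 0), two deltas below ([per n], [per n]). *)
by apply: sim_sym; exists 2; left.
Qed.

End Crystal.

Theorem theorem3p7 (n : nat) (hn : 2 <= n) :
  (* Phi is well defined: it takes values in level-1 slices *)
  (forall b : Bt n, inB b -> isSlice n (Phi b)) /\
  (* Phi : B -> S/~ is injective *)
  (forall b b' : Bt n, inB b -> inB b' -> sim n (Phi b) (Phi b') -> b = b') /\
  (* Phi : B -> S/~ is surjective *)
  (forall C : slice, isSlice n C -> exists b : Bt n, inB b /\ sim n (Phi b) C) /\
  (* Phi commutes with the Kashiwara operators f_i and e_i, i in I *)
  (forall (i : nat) (b : Bt n), i <= n -> inB b ->
     osim n (omap (@Phi n) (fB i b)) (fS n i (Phi b)) /\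
     osim n (omap (@Phi n) (eB i b)) (eS n i (Phi b))).
Proof.
split; [|split; [|split]].
- move=> b /(inB_mkP hn)[->|[p [q [hp hpq hq ->]]]].
    by rewrite Phi_mk11 // isSlice11.
  by rewrite Phi_mk // isSlice_canon.
(* An element of B can be read back from its canonical slice, so uniqueness of canonical slices
   gives injectivity. *)
- have rep b : inB b -> canon n (Phi b) /\ b = mk n (Phi b).1 (Phi b).2.
    move=> /(inB_mkP hn)[->|[p [q [hp hpq hq ->]]]].
      by rewrite Phi_mk11.
    by rewrite Phi_mk // /canon /= hp hpq hq orbT.
  move=> b b' /rep[hb eb] /rep[hb' eb'] /(canon_sim_eq hn hb hb') e.
  by rewrite eb eb' e.
- move=> C /(slice_sim_canon hn)[[p q] /orP[/eqP ->|/and3P[/= hp hpq hq]] hs].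
    by exists (mk n 1 1); rewrite Phi_mk11 // inB_mk11.
  by exists (mk n p q); rewrite Phi_mk //; split=> //; apply: inB_mk => //; lia.
- move=> i b hi /(inB_mkP hn)[->|[p [q [hp hpq hq ->]]]].
    by split; [apply: Phi_fB_mk11|apply: Phi_eB_mk11].
  case: (posnP i) => [->|hi0].
    by split; [apply: Phi_fB0|apply: Phi_eB0].
  have [->|hin] := eqVneq i n.
    by split; [apply: Phi_fBn|apply: Phi_eBn].
  by split; [apply: Phi_fB|apply: Phi_eB] => //; lia.
Qed.
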